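(* Let $n\ge 2$ and let $\tilde s=(\tilde s_1,\dots,\tilde s_n)\in\{0,1\}^n$. Let $G$ be the threshold graph with self-loops with creation sequence $\tilde s$: the graph on $\{1,\dots,n\}$ whose adjacency matrix $\tilde A$ is given by $\tilde A_{ij}=\tilde s_{\max(i,j)}$ for all $i,j$ (so vertex $i$ carries a self-loop iff $\tilde s_i=1$, and for $i<j$ the vertices $i,j$ are adjacent iff $\tilde s_j=1$). Write $\tilde s$ uniquely in run form \[ \tilde s=(\underbrace{1,\dots,1}_{k_1},\underbrace{0,\dots,0}_{l_1},\dots,\underbrace{1,\dots,1}_{k_m},\underbrace{0,\dots,0}_{l_m}), \] where $m\ge1$, $k_1,l_m\ge0$ and $k_2,\dots,k_m,l_1,\dots,l_{m-1}\ge1$. Set \[ \widetilde C_n(0)=n-2(m-1)-I_{\{1\}}(\tilde s_1),\qquad J=2(m-1)+I_{\{1\}}(\tilde s_1). \] Define $(a_1,\dots,a_J)$ by $a_{2r-1}=k_{m-r+1}$ and $a_{2r}=l_{m-r}$ for all indices in $\{1,\dots,J\}$ (so $(a_1,\dots,a_J)=(k_m,l_{m-1},k_{m-1},\dots,l_1,k_1)$ if $\tilde s_1=1$ and $(k_m,l_{m-1},k_{m-1},\dots,k_2,l_1)$ if $\tilde s_1=0$). Let $B$ be the $J\times J$ matrix with entries: for odd $p$, $B_{pq}=a_q$ if $q\ge p$, and for $q<p$, $B_{pq}=a_q$ if $q$ is odd and $B_{pq}=0$ if $q$ is even; for even $p$, $B_{pq}=a_q$ if $q<p$ and $q$ is odd,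 and $B_{pq}=0$ otherwise. Let $\lambda_1,\dots,\lambda_J$ be the eigenvalues of $B$ counted with algebraic multiplicity. Then the spectral distribution of $G$ is \[ \widetilde\mu_n(G)=\frac{\widetilde C_n(0)}{n}\,\delta_0+\frac1n\sum_{j=1}^J\delta_{\lambda_j}, \] and moreover every $\lambda_j$ is different from $0$.
   Context: The spectral distribution of a graph (possibly with self-loops) on $n$ vertices with adjacency matrix $\tilde A$ is $\frac1n\sum_{i=1}^n\delta_{\mu_i}$, where $\mu_1,\dots,\mu_n$ are the eigenvalues of $\tilde A$ with multiplicity; $\delta_x$ is the Dirac measure at $x$ and $I_{\{1\}}(\tilde s_1)$ equals $1$ if $\tilde s_1=1$ and $0$ otherwise. *)

(* Defs.v *)
From HB Require Import structures.
From mathcomp Require Import all_boot all_order all_algebra.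
From mathcomp Require Import complex.
From mathcomp Require Import all_classical all_reals all_analysis.

Set Implicit Arguments.
Unset Strict Implicit.
Unset Printing Implicit Defensive.

Import Order.TTheory GRing.Theory Num.Theory.
Import numFieldNormedType.Exports.

Local Open Scope ring_scope.

(* mu lists the eigenvalues of M with algebraic multiplicity, in any order. *)
Definition is_spectrum (F : closedFieldType) (n : nat) (M : 'M[F]_n)
    (mu : n.-tuple F) : Prop :=
  char_poly M = \prod_(i < n) ('X - (tnth mu i)%:P).

Lemma is_spectrum_ex (F : closedFieldType) (n : nat) (M : 'M[F]_n) :
  exists mu : n.-tuple F, is_spectrum M mu.
Proof.
have [r] := closed_field_poly_normal (char_poly M).
rewrite (monicP (char_poly_monic M)) scale1r => Mr.
have sz_r : size r == n.
  have := congr1 (fun p : {poly F} => size p) Mr.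
  by rewrite size_char_poly size_prod_XsubC => /eqP; rewrite eqSS eq_sym.
exists (Tuple sz_r); rewrite /is_spectrum Mr.
by rewrite -(big_tuple _ _ (Tuple sz_r) xpredT (fun z => 'X - z%:P)).
Qed.

Definition spectrum (F : closedFieldType) (n : nat) (M : 'M[F]_n) :
  n.-tuple F := projT1 (cid (is_spectrum_ex M)).

Lemma spectrumP (F : closedFieldType) (n : nat) (M : 'M[F]_n) :
  is_spectrum M (spectrum M).
Proof. exact: projT2 (cid (is_spectrum_ex M)). Qed.

(* The complex numbers with their Borel sigma-algebra; the topology is the one
   of the norm and is carried by the regular algebra R[i]^o. *)
Definition borelC (R : realType) := g_sigma_algebraType (@open (R[i]^o)).

(* A graph on n vertices, possibly with self-loops, is given by its adjacency
   relation. *)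
Definition adjacency_mx (F : nzRingType) (n : nat) (e : rel 'I_n) : 'M[F]_n :=
  \matrix_(i, j) (e i j)%:R.

(* A Borel measure on the complex plane rather than on the real line: it is
   supported on the reals because the adjacency matrix is symmetric, and it can
   be compared directly with Dirac masses at the eigenvalues of nonsymmetric
   matrices. *)
Definition spectral_distribution (R : realType) (n : nat) (e : rel 'I_n) :
    {measure set (borelC R) -> \bar R} :=
  mscale (n%:R^-1)%:nng
    (msum (fun i => \d_(nth 0 (spectrum (adjacency_mx R[i] e)) i : borelC R))
          n).

Definition threshold_graph (n : nat) (s : n.-tuple bool) : rel 'I_n :=
  fun i j => nth false s (maxn i j).

(* s = 1^(k 1) 0^(l 1) ... 1^(k m) 0^(l m); only the values of k and l at
   1, ..., m matter. *)
Definition run_form (s : seq bool) (m : nat) (k l : nat -> nat) : Prop :=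
  [/\ (1 <= m)%N,
      forall r, (2 <= r <= m)%N -> (1 <= k r)%N,
      forall r, (1 <= r <= m.-1)%N -> (1 <= l r)%N
    & s = flatten [seq nseq (k r) true ++ nseq (l r) false | r <- iota 1 m]].

(* The boolean s1 is the first entry of the creation sequence; its coercion to
   nat is the indicator of s1 = 1. *)
Definition zero_weight (n m : nat) (s1 : bool) : int :=
  n%:Z - (2 * (m - 1))%N%:Z - (s1 : nat)%:Z.

Definition red_size (m : nat) (s1 : bool) : nat := (2 * (m - 1) + s1)%N.

(* The run lengths in reverse order, k m, l (m-1), k (m-1), ..., indexed from
   1: at 2r-1 the value is k (m-r+1), at 2r it is l (m-r). *)
Definition rev_runs (m : nat) (k l : nat -> nat) (p : nat) : nat :=
  if odd p then k (m - p.+1./2 + 1)%N else l (m - p./2)%N.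

(* The indices p, q start from 1. *)
Definition red_entry (a : nat -> nat) (p q : nat) : nat :=
  if odd p then
    if (p <= q)%N then a q else if odd q then a q else 0%N
  else
    if (q < p)%N && odd q then a q else 0%N.

Definition red_mx (F : nzRingType) (J : nat) (a : nat -> nat) : 'M[F]_J :=
  \matrix_(i, j) (red_entry a i.+1 j.+1)%:R.

(* Main.v *)
(* Group the vertices by run, in reverse order of creation, and let P be the
   n x J incidence matrix of vertices against runs, the trailing zeros being in
   no class. Then A = P C P^T and B = C (P^T P) with C_pq = [min(p, q) is odd],
   so Sylvester's identity gives X^J char(A) = X^n char(B). Moreover
   C = L D L^T with L lower unitriangular and D = diag(1, -1, 1, ...), hence
   det B = +-prod_p a_p is nonzero. *)

Require Import Defs.
From HB Require Import structures.
From mathcomp Require Import all_boot all_order all_algebra.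
From mathcomp Require Import complex.
From mathcomp Require Import all_classical all_reals all_analysis.
From mathcomp Require Import zify ring.

Import Order.TTheory GRing.Theory Num.Theory.
Import numFieldNormedType.Exports.

Local Open Scope ring_scope.

(** Both sides equal ['X^J * \det M]. Clearing the lower left block of [M] from the right gives
    [\det M = char_poly (U *m V)]; clearing it from the left costs a factor ['X^J] and gives
    ['X^n * char_poly (V *m U)]. *)
Lemma char_poly_mulmxC (R : comNzRingType) (n J : nat)
    (U : 'M[R]_(n, J)) (V : 'M[R]_(J, n)) :
  'X^J * char_poly (U *m V) = 'X^n * char_poly (V *m U).
Proof.
rewrite /char_poly /char_poly_mx !map_mxM.
set u := map_mx _ U; set v := map_mx _ V.
pose M := block_mx 'X%:M u v 1%:M.
have MR : M *m block_mx 1%:M 0 (- v) 1%:M = block_mx ('X%:M - u *m v) u 0 1%:M.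
  by rewrite mulmx_block !(mulmx1, mulmx0, mul1mx, mulmxN, add0r) addrN.
have ML : block_mx 1%:M 0 (- v) 'X%:M *m M
    = block_mx 'X%:M u 0 ('X%:M - v *m u).
  rewrite mulmx_block !(mulmx1, mulmx0, mul1mx, mul0mx, mulNmx, addr0).
  by rewrite scalar_mxC addNr addrC.
have := congr1 determinant MR; have := congr1 determinant ML.
by rewrite !det_mulmx !det_lblock !det_ublock !det1 !det_scalar !mulr1 !mul1r
  => <- <-.
Qed.

(* Class 0, the trailing zeros of the creation sequence, has no column. *)
Definition class_mx (F : nzRingType) (n J : nat) (t : seq nat) : 'M[F]_(n, J) :=
  \matrix_(i, p) (nth 0%N t i == p.+1)%:R.

Definition core_mx (F : nzRingType) (J : nat) : 'M[F]_J :=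
  \matrix_(p, q) (odd (minn p.+1 q.+1))%:R.

(** The parity of the minimum is that of p when p <= q and that of q otherwise, so the case split
    collapses and a_q comes out as a column scaling. *)
Lemma red_entryE (a : nat -> nat) (p q : nat) :
  red_entry a p q = (odd (minn p q) * a q)%N.
Proof.
rewrite /red_entry; case: (leqP p q) => pq; last first.
  by case: (odd p); case: (odd q); rewrite ?mul1n ?mul0n.
by case: (odd p); rewrite ?mul1n ?mul0n.
Qed.

Lemma red_mxE (F : nzRingType) (J : nat) (a : nat -> nat) :
  red_mx F J a = core_mx F J *m diag_mx (\row_q (a q.+1)%:R).
Proof.
by apply/matrixP => p q; rewrite mul_mx_diag !mxE red_entryE natrM.
Qed.

Lemma core_mx_LDL (F : comNzRingType) (J : nat) :
  let L : 'M[F]_J := \matrix_(p, q) (q <= p)%:R in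
  core_mx F J = L *m diag_mx (\row_q (-1) ^+ q) *m L^T.
Proof.
move=> L; apply/matrixP => p q; rewrite mul_mx_diag !mxE.
(* With 0-based indices, the (p, q) entry of L D L^T is the alternating sum 1 - 1 + 1 - ... over r
   <= min(p, q), which is 1 or 0 according to parity. *)
transitivity (\sum_(r < (minn p q).+1) (-1) ^+ r : F).
  elim: (minn p.+1 q.+1) (minnSS p q) => // u _ ->.
  elim: (minn p q) => [|v IHv]; first by rewrite big_ord1.
  rewrite big_ord_recr /= -IHv /= -[in RHS]signr_odd /=.
  by case: (odd v); rewrite /= ?expr0 ?expr1 ?subrr ?add0r.
rewrite (big_ord_widen_cond J xpredT (fun r => (-1) ^+ r)); last first.
  by rewrite -minnSS; have := ltn_ord p; lia.
rewrite big_mkcond; apply: eq_bigr => r _; rewrite !mxE ltnS leq_min /=.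
by case: (r <= p)%N; case: (r <= q)%N; rewrite ?mul1r ?mulr1 ?mulr0 ?mul0r.
Qed.

Lemma det_core_mx_neq0 (F : numDomainType) (J : nat) : \det (core_mx F J) != 0.
Proof.
rewrite core_mx_LDL !det_mulmx det_tr det_diag det_trig; last first.
  by apply/is_trig_mxP => i j ij; rewrite mxE leqNgt ij.
rewrite !mulf_neq0 //; apply/prodf_neq0 => i _;
  rewrite mxE ?leqnn ?oner_neq0 //.
by rewrite signr_eq0.
Qed.

Lemma det_red_mx_neq0 (F : numDomainType) (J : nat) (a : nat -> nat) :
  (forall p, (1 <= p <= J)%N -> (0 < a p)%N) -> \det (red_mx F J a) != 0.
Proof.
move=> a_gt0; rewrite red_mxE det_mulmx mulf_neq0 ?det_core_mx_neq0 //.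
rewrite det_diag; apply/prodf_neq0 => i _.
by rewrite mxE pnatr_eq0 -lt0n a_gt0 //=.
Qed.

(** Distinct columns of the incidence matrix have disjoint supports, and each column has as many
    ones as its class has vertices. *)
Lemma tr_class_mxM (F : nzRingType) (J : nat) (a : nat -> nat) (t : seq nat) :
  (forall p, (1 <= p <= J)%N -> count_mem p t = a p) ->
  (class_mx F (size t) J t)^T *m class_mx F (size t) J t
  = diag_mx (\row_q (a q.+1)%:R).
Proof.
move=> ta; apply/matrixP => p q; rewrite !mxE -ta /= ?ltn_ord //.
transitivity (\sum_(x <- t) ((x == q.+1) && (p == q))%:R : F).
  rewrite [RHS](big_nth 0%N) big_mkord; apply: eq_bigr => i _; rewrite !mxE.
  have [->|pq] := eqVneq p q; first by rewrite andbT -natrM mulnb andbb.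
  rewrite andbF; have [e|] := eqVneq (nth _ _ _) q.+1; rewrite ?mulr0 // e.
  by rewrite eqSS (inj_eq val_inj) eq_sym (negPf pq) mul0r.
have [->|pq] := eqVneq p q; last by rewrite big1 // => x _; rewrite andbF.
rewrite mulr1n -sum1_count -natr_sum [in RHS]big_mkcond /=; congr _%:R.
by apply: eq_bigr => x _; rewrite andbT; case: (_ == _).
Qed.

Lemma adjacency_mxE (F : comNzRingType) (n J : nat) (s : n.-tuple bool)
    (t : seq nat) :
  sorted geq t -> all (leq^~ J) t -> s = map odd t :> seq bool ->
  adjacency_mx F (threshold_graph s)
  = class_mx F n J t *m core_mx F J *m (class_mx F n J t)^T.
Proof.
move=> t_sorted tJ st; have sz_t : size t = n.
  by rewrite -(size_tuple s) st size_map.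
apply/matrixP => i j; rewrite !mxE /threshold_graph st.
have hi := ltn_ord i; have hj := ltn_ord j.
have odd_t u : nth false (map odd t) u = odd (nth 0%N t u).
  have [ut|ut] := ltnP u (size t); first by rewrite (nth_map 0%N).
  by rewrite !nth_default ?size_map.
(* Classes decrease along the creation order, so the later vertex has the smaller class. *)
have -> : nth false (map odd t) (maxn i j)
    = odd (minn (nth 0%N t i) (nth 0%N t j)).
  have geq_tr : transitive geq by move=> x y z /= xy yz; apply: leq_trans yz xy.
  have t_mono u v : (u <= v < n)%N -> (nth 0 t v <= nth 0 t u)%N.
    move=> /andP[uv vn]; apply: (sorted_leq_nth geq_tr leqnn) => //.
      by rewrite inE sz_t (leq_ltn_trans uv).
    by rewrite inE sz_t.
  rewrite odd_t; case: (leqP i j) => ij.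
    by rewrite (minn_idPr _) // t_mono // ij.
  by rewrite (minn_idPl _) // t_mono // ltnW.
have tJi u : (nth 0 t u <= J)%N.
  have [ut|ut] := ltnP u (size t); last by rewrite nth_default.
  by move/all_nthP: tJ => /(_ 0%N _ ut).
(* Summing against the incidence row of a vertex of class x selects the entry at x, or gives 0 for
   class 0, which has no column. *)
have pick x (f : 'I_J -> F) g : (x <= J)%N -> (forall p, f p = g p.+1) ->
    \sum_(p < J) f p * (x == p.+1)%:R = if x is 0%N then 0 else g x.
  case: x => [_ _|x xJ fg]; first by rewrite big1 // => p _; rewrite mulr0.
  rewrite (bigD1 (Ordinal xJ)) //= eqxx mulr1 fg big1 ?addr0 // => p px.
  rewrite eqSS; case: eqP => [e|]; last by rewrite mulr0.
  by case/eqP: px; apply: val_inj.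
under eq_bigr => q _ do rewrite [in X in _ * X]mxE [in X in _ * X]mxE.
rewrite (pick _ _ (fun q => if nth 0%N t i is 0%N then 0
                        else (odd (minn (nth 0%N t i) q))%:R)) //.
  (* If either class is 0, the minimum is 0, hence even, in agreement with the zero from [pick]. *)
  by case: (nth 0%N t i) => [|x]; case: (nth 0%N t j) => [|y];
    rewrite ?minn0 ?min0n.
move=> q; rewrite mxE.
under eq_bigr => p _ do rewrite [class_mx _ _ _ _ _ _]mxE mulrC.
by apply: (pick _ _ (fun p => (odd (minn p q.+1))%:R)) => // p; rewrite mxE.
Qed.

Lemma char_poly_adjacency_mx (F : comNzRingType) (n J : nat) (s : n.-tuple bool)
    (a : nat -> nat) (t : seq nat) :
  sorted geq t -> all (leq^~ J) t ->
  (forall p, (1 <= p <= J)%N -> count_mem p t = a p) ->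
  s = map odd t :> seq bool ->
  'X^J * char_poly (adjacency_mx F (threshold_graph s))
  = 'X^n * char_poly (red_mx F J a).
Proof.
move=> t_sorted tJ ta st; have sz_t : size t = n.
  by rewrite -(size_tuple s) st size_map.
rewrite (@adjacency_mxE _ _ J _ t) // -mulmxA mulmxA -mulmxA char_poly_mulmxC.
by rewrite red_mxE -(@tr_class_mxM _ _ _ t) // sz_t mulmxA.
Qed.

(* The classes in reverse order of creation; the bit of class p is [odd p]. *)
Definition class_seq (a : nat -> nat) (J : nat) : seq nat :=
  flatten [seq nseq (a p) p | p <- iota 0 J.+1].

Lemma count_class_seq (a : nat -> nat) (J p : nat) :
  (p <= J)%N -> count_mem p (class_seq a J) = a p.
Proof.
move=> pJ; rewrite /class_seq count_flatten -map_comp sumnE big_map.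
under eq_bigr => q _ do rewrite /= count_nseq.
rewrite (bigD1_seq p) ?mem_iota ?iota_uniq //= eqxx mul1n.
by rewrite big1 ?addn0 // => q /negPf qp; rewrite qp mul0n.
Qed.

Lemma class_seq_le (a : nat -> nat) (J : nat) : all (leq^~ J) (class_seq a J).
Proof.
apply/allP => x /flatten_mapP[p]; rewrite mem_iota /= add0n ltnS => pJ.
by rewrite mem_nseq => /andP[_ /eqP->].
Qed.

Lemma class_seq_sorted (a : nat -> nat) (J : nat) : sorted leq (class_seq a J).
Proof.
rewrite sorted_pairwise; last exact: leq_trans.
elim: J => [|J]; rewrite /class_seq.
  rewrite /= cats0; elim: (a _) => //= u ->; rewrite andbT.
  by apply/allP.
rewrite -[J.+2]addn1 iotaD map_cat flatten_cat pairwise_cat => ->.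
rewrite /= cats0; apply/andP; split.
  apply/allrelP => x y xJ /nseqP[-> _]; apply: leqW.
  exact: (allP (class_seq_le a J)).
by elim: (a _) => //= u ->; rewrite andbT; apply/allP => x /nseqP[->].
Qed.

(** By induction on m: the last block of ones and zeros becomes classes 1 and 0, and every earlier
    class index shifts by 2, which preserves its parity. *)
Lemma rev_runs_flatten (m : nat) (k l : nat -> nat) :
  (1 <= m)%N ->
  rev (flatten [seq nseq (k r) true ++ nseq (l r) false | r <- iota 1 m])
  = map odd (class_seq (rev_runs m k l) (2 * m).-1).
Proof.
move=> m_gt0; rewrite /class_seq prednK ?muln_gt0 //.
have rev_nseq (T : Type) u (x : T) : rev (nseq u x) = nseq u x.
  elim: u => //= u IHu; rewrite rev_cons IHu.
  by elim: u {IHu} => //= u ->.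
elim: m {m_gt0} => [//|m IHm].
rewrite -[X in iota 1 X]addn1 iotaD map_cat flatten_cat rev_cat {}IHm mulnS.
move: (2 * m)%N => u.
rewrite /= cats0 add1n rev_cat !rev_nseq !map_cat !map_nseq /= -catA.
rewrite {2 3}/rev_runs /= subn0 subn1 addn1.
congr (_ ++ (_ ++ _)).
rewrite (iotaDl 2 0) -map_comp !map_flatten -!map_comp; congr flatten.
apply: eq_map => p /=; rewrite !map_nseq /= negbK /rev_runs /= negbK.
by case: (odd p); rewrite ?subSS.
Qed.

Lemma run_form_classes (s : seq bool) (m : nat) (k l : nat -> nat) :
  run_form s m k l ->
  let J := red_size m (nth false s 0) in
  s = map odd (rev (class_seq (rev_runs m k l) J)) /\
  forall p, (1 <= p <= J)%N -> (0 < rev_runs m k l p)%N.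
Proof.
case=> m_gt0 k_gt0 l_gt0 sE J.
(* If k_1 = 0, then s starts with a zero, unless l_1 = 0 as well. The latter forces m = 1 and s
   empty, where [nth] returns its default [false]. *)
have s1E : nth false s 0 = (0 < k 1)%N.
  rewrite sE; case: m m_gt0 k_gt0 l_gt0 {sE J} => // m _ _ l_gt0 /=.
  rewrite -catA; case: (k 1) => [|//] /=.
  case: (posnP (l 1)) => [l1|]; last by case: (l 1).
  by case: m l_gt0 => [_|m /(_ 1%N isT)]; rewrite l1.
split.
  apply: (can_inj revK); rewrite {1}sE rev_runs_flatten // -map_rev revK.
  (* When k_1 = 0, J is 2m-2 instead of 2m-1, and the dropped class 2m-1 is the empty first run. *)
  rewrite /J /red_size s1E; case: (posnP (k 1)) => [k1|k1]; last first.
    by congr (map _ (class_seq _ _)); lia.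
  have -> : (2 * m).-1 = (2 * (m - 1)).+1 by lia.
  rewrite /class_seq -[(2 * (m - 1)).+2]addn1 iotaD map_cat flatten_cat /=.
  have -> : rev_runs m k l (0 + (2 * (m - 1)).+1) = 0%N.
    rewrite add0n /rev_runs mul2n /= odd_double doubleK -k1; congr k; lia.
  by rewrite /= addn0 cats0.
move=> p; rewrite /J /red_size s1E /rev_runs => pJ.
have := odd_double_half p; case: (odd p) => p2; last by apply: l_gt0; lia.
(* Only p = 2m-1 reads k_1, and this p is at most J exactly when k_1 > 0. *)
have [m1|] := eqVneq (m - p.+1./2 + 1)%N 1%N; last first.
  by move=> ?; apply: k_gt0; lia.
by rewrite m1; case: (posnP (k 1)) pJ => // k1; lia.
Qed.

(** Up to sign, the determinant is the constant term of the characteristic polynomial, which a zero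
    root would annihilate. *)
Lemma spectrum_neq0 (F : closedFieldType) (J : nat) (M : 'M[F]_J)
    (lam : J.-tuple F) (j : 'I_J) :
  is_spectrum M lam -> \det M != 0 -> tnth lam j != 0.
Proof.
move=> Mlam; apply: contra_neq => lam0.
have := char_poly_det M; rewrite -horner_coef0 Mlam horner_prod (bigD1 j) //=.
rewrite hornerXsubC lam0 subr0 mul0r => /esym/eqP.
by rewrite mulf_eq0 signr_eq0 => /eqP.
Qed.

Theorem theorem2 (R : realType) (n : nat) (s : n.-tuple bool) (m : nat)
    (k l : nat -> nat) :
  (2 <= n)%N ->
  run_form s m k l ->
  let s1 := nth false s 0 in
  let J := red_size m s1 in
  forall lam : J.-tuple R[i],
  is_spectrum (red_mx R[i] J (rev_runs m k l)) lam ->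
  (forall X : set (borelC R), measurable X ->
     (spectral_distribution R (threshold_graph s) X =
      ((zero_weight n m s1)%:~R / n%:R)%R%:E * \d_((0%R : R[i]) : borelC R) X
      + (n%:R^-1)%R%:E * \sum_(j < J) \d_(tnth lam j : borelC R) X)%E)
  /\ (forall j : 'I_J, tnth lam j != 0).
Proof.
move=> n_ge2 srun s1 J lam lamP.
have [sE a_gt0] := run_form_classes _ _ _ _ srun.
split=> [X _|j]; last first.
  exact: spectrum_neq0 lamP (det_red_mx_neq0 _ _ _ a_gt0).
set mu := spectrum (adjacency_mx R[i] (threshold_graph s)).
have muP : is_spectrum _ mu := spectrumP _.
set t := rev (class_seq (rev_runs m k l) J).
have t_sorted : sorted geq t by rewrite rev_sorted; exact: class_seq_sorted.
have tJ : all (leq^~ J) t by rewrite all_rev; exact: class_seq_le.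
have ta p : (1 <= p <= J)%N -> count_mem p t = rev_runs m k l p.
  by move=> /andP[_ pJ]; rewrite count_rev count_class_seq.
(* Each padding zero contributes a factor X, so the identity between characteristic polynomials
   becomes an equality of multisets of roots. *)
have mulam : perm_eq (nseq J 0 ++ mu) (nseq n 0 ++ lam).
  apply: prod_XsubC_eq; rewrite !big_cat !big_nseq !big_tuple /=.
  rewrite -muP -lamP !subr0 !iter_mulr_1.
  exact: char_poly_adjacency_mx _ _ _ _ _ _ t_sorted tJ ta sE.
have nE : n%:R != 0 :> R by rewrite pnatr_eq0; lia.
have zE : (zero_weight n m s1)%:~R = n%:R - J%:R :> R.
  by rewrite /zero_weight !rmorphB /= -addrA -opprD -natrD.
(* Summing the indicator of X over both lists gives J 1_X(0) + sum over mu = n 1_X(0) + sum over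
   lam; solving for the sum over mu leaves the weight n - J at 0. *)
have := perm_big (op := +%R) (x := 0) _ mulam
  (P := xpredT) (F := fun z => (z \in X)%:R : R).
rewrite /= !big_cat /= !big_nseq !iter_addr_0 !big_tuple => sumE.
have -> : spectral_distribution R (threshold_graph s) X
    = (n%:R^-1 * \sum_(i < n) (tnth mu i \in X)%:R)%:E.
  rewrite /= /mscale /= /msum EFinM -sumEFin; congr (_ * _)%E.
  by apply: eq_bigr => i _; rewrite (tnth_nth 0); exact: diracE.
under eq_bigr do rewrite diracE.
rewrite diracE sumEFin -!EFinM -EFinD; congr (_%:E).
move: sumE; rewrite -!(mulr_natr (_ \in X)%:R) zE.
move=> /(canRL (addKr _)) ->; field; exact: nE.
Qed.
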